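(* Let $T$ be a finite abelian group, let $\psi\colon T\to\mathbb{R}/\mathbb{Z}$ be $2$-linear and tame, with associated bilinear form $b$, and let $h\colon T\to\mathbb{Q}/\mathbb{Z}$ be a homomorphism. Put $\psi_h(t)=\psi(t)+h(t)$. Then $\psi_h$ is tame if and only if $h(T^\perp)=0$. If $\psi_h$ is tame, let $c\in T/T^\perp$ be the unique element such that $h(t)=b(c_1,t)$ for all $t\in T$ and any lift $c_1\in T$ of $c$. Then the value $\psi(c_1)$ is the same for all $c_1\in T$ reducing to $c$; denoting this common value by $\psi(c)$, one has $$\beta(\psi_h)=\beta(\psi)-\psi(c)\in\mathbb{R}/\mathbb{Z}.$$
   Context: A function $\psi\colon T\to\mathbb{R}/\mathbb{Z}$ on a finite abelian group is $2$-linear if $b(x,y)=\psi(x+y)-\psi(x)-\psi(y)$ is bilinear; $b$ is the associated bilinear form. (A $2$-linear function automatically takes values in $\mathbb{Q}/\mathbb{Z}$.) $T^\perp=\{t\in T: b(t,s)=0\ \forall s\in T\}$. $\psi$ is tame if $\psi|_{T^\perp}=0$. Note that $\psi_h$ has the same associated bilinear form as $\psi$. The Gauss sum is $G(\psi)=\sum_{t\in T}e^{2\pi i\psi(t)}$, which is non-zero for tame $\psi$, and the phase $\beta(\psi)\in\mathbb{R}/\mathbb{Z}$ is defined, when $G(\psi)\ne0$, by $G(\psi)=|G(\psi)|\,e^{2\pi i\beta(\psi)}$. *)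

(* Defs.v *)
From HB Require Import structures.
From mathcomp Require Import all_boot all_order all_algebra all_fingroup.
From mathcomp Require Import complex.
From mathcomp Require Import boolp classical_sets reals topology normedtype.
From mathcomp Require Import trigo ring lra.

Set Implicit Arguments.
Unset Strict Implicit.
Unset Printing Implicit Defensive.

Import Order.TTheory GRing.Theory Num.Theory.

Local Open Scope ring_scope.
Local Open Scope quotient_scope.
Local Open Scope complex_scope.

(* Num.int, packaged as an additive subgroup of R *)
Definition Rint (R : realType) : zmodClosed R :=
  GRing.ZmodClosed.clone R (@Num.int_num_subdef R) _.

Notation RmodZ R := (Quotient.quot (Rint R)).

(* as a subgroup of R/Z *)
Definition QmodZ (R : realType) : set (RmodZ R) :=
  [set \pi_(RmodZ R) (ratr q) | q in [set: rat]]%classic.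

(* u |-> e^(2 pi i u); by expRZ_pi, the choice of representative is irrelevant *)
Definition expRZ (R : realType) (u : RmodZ R) : R[i] :=
  cos (2 * pi * generic_quotient.repr u) +i* sin (2 * pi * generic_quotient.repr u).

Section RmodZTheory.
Variable R : realType.
Implicit Types (x y : R) (u v : RmodZ R).

Lemma eq_piRmodZ x y : (\pi_(RmodZ R) x == \pi y) = (x - y \is a Num.int).
Proof. by rewrite -Quotient.idealrBE. Qed.

Lemma cosDint x (m : int) : cos (2 * pi * (x + m%:~R)) = cos (2 * pi * x).
Proof.
have P := periodicn (@cosD2pi R).
case: (intP m) => [|n|n]; first by rewrite addr0.
  by rewrite -[RHS](P n.+1); congr cos; rewrite -mulr_natr; ring.
by rewrite -[LHS](P n.+1); congr cos; rewrite -mulr_natr; ring.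
Qed.

Lemma sinDint x (m : int) : sin (2 * pi * (x + m%:~R)) = sin (2 * pi * x).
Proof.
have P := periodicn (@sinD2pi R).
case: (intP m) => [|n|n]; first by rewrite addr0.
  by rewrite -[RHS](P n.+1); congr sin; rewrite -mulr_natr; ring.
by rewrite -[LHS](P n.+1); congr sin; rewrite -mulr_natr; ring.
Qed.

Lemma expRZ_pi x : expRZ (\pi x) = cos (2 * pi * x) +i* sin (2 * pi * x).
Proof.
rewrite /expRZ; set y := generic_quotient.repr _.
have : \pi_(RmodZ R) y == \pi x by rewrite /y reprK.
rewrite eq_piRmodZ => /intrP[m ym].
have -> : y = x + m%:~R by rewrite -ym; ring.
by rewrite cosDint sinDint.
Qed.

Lemma cos2pi_eq1 x : cos (2 * pi * x) = 1 -> x \is a Num.int.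
Proof.
have pi0 := pi_gt0 R; have /andP[] := floor_itv x.
set m := Num.floor x => m1; rewrite intrD => m2.
rewrite -(cosDint x (- m)) => cx.
set d := x + (- m)%:~R in cx.
have d0 : 0 <= d by rewrite /d intrN subr_ge0.
have d1 : d < 1 by rewrite /d intrN; lra.
have {cx} : d = 0 \/ 1 - d = 0.
  have half y : 0 <= y <= 1 / 2 -> cos (2 * pi * y) = 1 -> y = 0.
    move=> /andP[y0 y1] cy; have : 2 * pi * y = 0.
      apply: (@cos_inj R); rewrite ?cos0 // in_itv /= ?lexx ?pi_ge0 //.
      by apply/andP; split; nra.
    by move/eqP; rewrite !mulf_eq0 pnatr_eq0 (gt_eqF pi0) /= => /eqP.
  have [h|h] := leP d (1 / 2); [left|right]; apply: half => //.
  - by rewrite d0.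
  - by apply/andP; split; lra.
  - by rewrite (_ : 1 - d = - d + 1%:~R) ?cosDint ?mulrN ?cosN // addrC.
move=> [d00|d10]; last by lra.
apply/intrP; exists m; move: d00; rewrite /d intrN; lra.
Qed.

Lemma expRZ_inj : injective (@expRZ R).
Proof.
move=> u v; rewrite -[u]reprK -[v]reprK !expRZ_pi.
set x := generic_quotient.repr u; set y := generic_quotient.repr v => -[cxy sxy].
apply/eqP; rewrite eq_piRmodZ; apply: cos2pi_eq1.
by rewrite mulrBr cosB cxy sxy -!expr2 cos2Dsin2.
Qed.

Lemma expRZ_surj (z : R[i]) : `|z| = 1 -> exists u, z = expRZ u.
Proof.
case: z => a b; rewrite normc_def => /eqP; rewrite eq_complex /= eqxx andbT => /eqP ab.
have {}ab : a ^+ 2 + b ^+ 2 = 1.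
  by rewrite -[LHS]sqr_sqrtr ?addr_ge0 ?sqr_ge0 // ab expr1n.
have a1 : -1 <= a <= 1 by apply/andP; split; nra.
have pi0 := pi_gt0 R; have b2 : 1 - a ^+ 2 = b ^+ 2 by rewrite -ab; ring.
have twopiK t : 2 * pi * (t / (2 * pi)) = t :> R.
  by rewrite mulrC divfK // gt_eqF // mulr_gt0.
have ca : cos (acos a) = a by rewrite acosK // in_itv.
have sa : sin (acos a) = `|b| by rewrite sin_acos // b2 sqrtr_sqr.
have [b0|b0] := leP 0 b.
  exists (\pi_(RmodZ R) (acos a / (2 * pi))).
  by rewrite expRZ_pi twopiK ca sa ger0_norm.
exists (\pi_(RmodZ R) (- acos a / (2 * pi))).
by rewrite expRZ_pi twopiK cosN sinN ca sa ltr0_norm // opprK.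
Qed.

End RmodZTheory.

Section TwoLinear.
Variables (R : realType) (T : finZmodType).
Implicit Types (psi : T -> RmodZ R) (h : {additive T -> RmodZ R}).

Definition assoc_form psi (x y : T) : RmodZ R := psi (x + y) - psi x - psi y.

Definition biadditive (b : T -> T -> RmodZ R) : Prop :=
  (forall y, {morph b^~ y : x1 x2 / x1 + x2}) /\
  (forall x, {morph b x : y1 y2 / y1 + y2}).

Definition two_linear psi : Prop := biadditive (assoc_form psi).

Definition perp psi : {set T} := [set t | [forall s, assoc_form psi t s == 0]].

Definition tame psi : Prop := forall t, t \in perp psi -> psi t = 0.

Definition twist psi (h : T -> RmodZ R) (t : T) : RmodZ R := psi t + h t.

Definition gauss_sum psi : R[i] := \sum_(t : T) expRZ (psi t).

(* only meaningful when the Gauss sum is non-zero, see phaseP *)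
Definition phase psi : RmodZ R :=
  xget 0 [set u | gauss_sum psi = `|gauss_sum psi| * expRZ u]%classic.

(* T / perp psi is the group quotient coset_of (perp psi), which relies on
   group_set_perp below and on the group law of T as a finGroupType being its
   addition *)
Definition represents psi (h : T -> RmodZ R) (c : coset_of (perp psi)) : Prop :=
  forall c1 : T, coset (perp psi) c1 = c ->
  forall t, h t = assoc_form psi c1 t.

Lemma perpP psi t :
  reflect (forall s, assoc_form psi t s = 0) (t \in perp psi).
Proof. by rewrite inE; apply: (iffP forallP) => h s; apply/eqP/h. Qed.

Lemma group_set_perp psi : two_linear psi -> group_set (perp psi).
Proof.
move=> [bl _]; apply/group_setP; split=> [|x y /perpP hx /perpP hy].
  apply/perpP => s; apply: (addIr (assoc_form psi 0 s)).
  by rewrite -bl /= addr0 add0r.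
by apply/perpP => s; rewrite [LHS]bl /= hx hy addr0.
Qed.

Lemma coset_perp_eq psi (x y : T) : two_linear psi ->
  (coset (perp psi) x == coset (perp psi) y) = (x - y \in perp psi).
Proof.
move=> psi2; pose P := Group (group_set_perp psi2).
have nP z : z \in 'N(P)%g.
  have := sub_abelian_norm (FinRing.zmod_abelian [set: T]) (finset.subsetT P).
  by move/fintype.subsetP->; rewrite ?inE.
rewrite -(inj_eq val_inj) /= -[perp psi]/(P : {set T}).
rewrite !val_coset //.
by apply/eqP/idP => [/rcoset_eqP | h]; [|apply/rcoset_eqP]; rewrite mem_rcoset.
Qed.

Lemma coset_perp_surj psi (c : coset_of (perp psi)) :
  exists c1 : T, coset (perp psi) c1 = c.
Proof. by have [x _ ->] := cosetP c; exists x. Qed.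

Lemma assoc_form_twist psi h x y :
  assoc_form (twist psi h) x y = assoc_form psi x y.
Proof.
rewrite /assoc_form /twist raddfD !opprD; move: (h x) (h y) => a b.
by rewrite [X in X + _]addrACA [a + b]addrC addrK addrACA subrr addr0.
Qed.

Lemma two_linear_twist psi h : two_linear psi -> two_linear (twist psi h).
Proof.
move=> [bl br]; split=> [y x1 x2|x y1 y2]; rewrite /= !assoc_form_twist.
  exact: bl.
exact: br.
Qed.

Lemma phaseP psi u : gauss_sum psi != 0 ->
  gauss_sum psi = `|gauss_sum psi| * expRZ u <-> u = phase psi.
Proof.
set G := gauss_sum psi => G0; have nG0 : `|G| != 0 by rewrite normr_eq0.
have [w Gw] : exists w, G / `|G| = expRZ w.
  by apply: expRZ_surj; rewrite normrM normfV normr_id divff.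
have {}Gw : G = `|G| * expRZ w by rewrite -Gw mulrCA divff // mulr1.
have -> : phase psi = w.
  apply: xget_unique => //= v Gv; apply: expRZ_inj.
  by apply: (mulfI nG0); rewrite -Gv -Gw.
split=> [Gu|->//]; apply: expRZ_inj.
by apply: (mulfI nG0); rewrite -Gu -Gw.
Qed.

End TwoLinear.

Arguments represents {R T} psi h c.

(* Main.v *)
(** Summing the characters t |-> h(t) + b(c,t) over all (c,t) in both orders
    shows that a homomorphism h vanishing on T^perp has the form b(c1,.): the
    order "c first" leaves the non-zero value |T| |T^perp|, while the order
    "t first" would give 0 if h were none of the b(c,.). The same orthogonality
    gives G(psi) * sum_t e(- psi t) = |T| |T^perp| for psi tame, whence
    G(psi) <> 0. Finally psi(t) + b(c1,t) = psi(t + c1) - psi(c1), so that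
    translating the summation variable yields G(psi_h) = e(- psi c1) G(psi). *)
Require Import Defs.
From HB Require Import structures.
From mathcomp Require Import all_boot all_order all_algebra all_fingroup.
From mathcomp Require Import complex.
From mathcomp Require Import boolp classical_sets reals topology normedtype.
From mathcomp Require Import trigo.

Import Order.TTheory GRing.Theory Num.Theory.
Local Open Scope ring_scope.

Section ExpRZ.
Local Open Scope quotient_scope.
Variable R : realType.
Implicit Types u v : RmodZ R.

Lemma expRZD u v : expRZ (u + v) = expRZ u * expRZ v.
Proof.
rewrite -[u]reprK -[v]reprK -[_ + _]Quotient.pi_add !expRZ_pi mulrDr cosD sinD.
by apply/eqP; rewrite eq_complex /= eqxx /= addrC.
Qed.

Lemma expRZ0 : expRZ (0 : RmodZ R) = 1.
Proof.
have -> : 0 = \pi_(RmodZ R) 0 by rewrite piE.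
by rewrite expRZ_pi mulr0 cos0 sin0.
Qed.

Lemma normr_expRZ u : `|expRZ u| = 1.
Proof. by rewrite /expRZ normc_def /= cos2Dsin2 sqrtr1. Qed.

End ExpRZ.

Section CharacterSums.
Variables (R : realType) (T : finZmodType).
Implicit Types (chi : T -> RmodZ R) (psi : T -> RmodZ R).

(** Translating the summation variable by [a] multiplies the sum by [expRZ (chi a)], and this factor
    is not 1 because [expRZ] is injective. *)
Lemma sum_expRZ_nontrivial chi a : {morph chi : x y / x + y} -> chi a != 0 ->
  \sum_t expRZ (chi t) = 0.
Proof.
move=> chiD chia; set S := \sum_t _.
have /eqP : expRZ (chi a) * S = S.
  rewrite [RHS](reindex_inj (addrI a)) mulr_sumr.
  by apply: eq_bigr => t _; rewrite chiD expRZD.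
rewrite -subr_eq0 -{2}[S]mul1r -mulrBl mulf_eq0 subr_eq0 -(expRZ0 R).
by rewrite (inj_eq (@expRZ_inj R)) (negPf chia) => /eqP.
Qed.

Lemma sum_expRZ_trivial chi : (forall t, chi t = 0) ->
  \sum_t expRZ (chi t) = #|T|%:R.
Proof.
move=> chi0; rewrite (eq_bigr (fun=> 1)); first by rewrite sumr_const.
by move=> t _; rewrite chi0 expRZ0.
Qed.

Lemma assoc_formC psi x y : assoc_form psi x y = assoc_form psi y x.
Proof. by rewrite /assoc_form addrAC [y + x]addrC. Qed.

Lemma two_linearD psi x y : psi (x + y) = assoc_form psi x y + psi x + psi y.
Proof. by rewrite /assoc_form addrAC !subrK. Qed.

Lemma sum_expRZ_assoc_form psi x : two_linear psi ->
  \sum_t expRZ (assoc_form psi x t) = (x \in perp psi)%:R * #|T|%:R.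
Proof.
move=> [_ br]; case: (perpP psi x) => [x0|/existsNP[s /eqP xs]].
  by rewrite mul1r sum_expRZ_trivial.
by rewrite mul0r (sum_expRZ_nontrivial _ s (br x) xs).
Qed.

Lemma perp_card_neq0 psi : two_linear psi ->
  #|perp psi|%:R * #|T|%:R != 0 :> complex R.
Proof.
move=> psi2.
have perp0 : 0 \in perp psi by have /group_setP[] := group_set_perp psi2.
rewrite -natrM pnatr_eq0 -lt0n muln_gt0.
by apply/andP; split; apply/card_gt0P; exists 0.
Qed.

(** The second factor is kept in the shape of a character sum of [assoc_form psi t], so that the
    left side can be expanded into a double sum. It is applied to [h] and to [psi] itself. *)
Lemma sum_perp_expRZ psi chi : (forall t, t \in perp psi -> chi t = 0) ->
  \sum_t expRZ (chi t) * ((t \in perp psi)%:R * #|T|%:R) =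
  #|perp psi|%:R * #|T|%:R.
Proof.
move=> chi0; rewrite -[#|perp psi|]sum1_card natr_sum mulr_suml big_mkcond /=.
rewrite [RHS]big_mkcond; apply: eq_bigr => t _.
by case: ifP => [/chi0->|_]; rewrite ?expRZ0 ?mul0r ?mulr0 ?mul1r.
Qed.

Lemma assoc_form_represents psi (h : T -> RmodZ R) :
  two_linear psi -> {morph h : x y / x + y} ->
  (forall t, t \in perp psi -> h t = 0) ->
  exists c1, forall t, h t = assoc_form psi c1 t.
Proof.
move=> psi2 hD h0; apply: contrapT => noc.
have /eqP := perp_card_neq0 _ psi2; apply.
rewrite -(sum_perp_expRZ _ _ h0).
under eq_bigr => t _ do rewrite -(sum_expRZ_assoc_form _ _ psi2) mulr_sumr.
rewrite exchange_big big1 //= => c _.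
(* Otherwise [h] would be the negative of the form at [c], hence represented by [- c]. *)
have [a ha] : exists a, h a + assoc_form psi a c != 0.
  apply: contrapT => none; apply: noc; exists (- c) => t.
  have [bl _] := psi2; have b0 : assoc_form psi 0 t = 0.
    by apply: (addrI (assoc_form psi 0 t)); rewrite -bl /= !addr0.
  have -> : h t = - assoc_form psi c t.
    apply/eqP; rewrite -addr_eq0 [assoc_form psi c t]assoc_formC.
    by apply: contrapT => /negP ht; apply: none; exists t.
  by apply/esym/eqP; rewrite -addr_eq0 -bl /= addNr b0.
under eq_bigr => t _ do rewrite -expRZD.
apply: (sum_expRZ_nontrivial _ a) ha => x y.
by have [bl _] := psi2; rewrite hD bl addrACA.
Qed.

Lemma gauss_sum_neq0 psi : two_linear psi -> tame psi -> gauss_sum psi != 0.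
Proof.
move=> psi2 psi_tame; apply/eqP => G0.
have /eqP := perp_card_neq0 _ psi2; apply.
rewrite -(sum_perp_expRZ _ _ psi_tame).
transitivity ((\sum_t expRZ (- psi t)) * gauss_sum psi); last by rewrite G0 mulr0.
under eq_bigr => u _ do rewrite -(sum_expRZ_assoc_form _ _ psi2) mulr_sumr.
rewrite exchange_big mulr_suml; apply: eq_bigr => t _.
(* With the Gauss sum shifted by [t], the terms agree since psi(u + t) - psi(t) = psi(u) +
   b(u,t). *)
rewrite /gauss_sum [in RHS](reindex_inj (addIr t)) mulr_sumr; apply: eq_bigr => u _.
by rewrite -!expRZD two_linearD; congr expRZ; rewrite addrC [RHS]addrC addrK.
Qed.

Lemma gauss_sum_twist psi (h : T -> RmodZ R) c1 :
  (forall t, h t = assoc_form psi c1 t) ->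
  gauss_sum (twist psi h) = expRZ (- psi c1) * gauss_sum psi.
Proof.
move=> hE; rewrite /gauss_sum [in RHS](reindex_inj (addrI c1)) mulr_sumr.
apply: eq_bigr => t _.
rewrite -expRZD /twist hE two_linearD; congr expRZ.
by rewrite [RHS]addrC [X in X - _]addrAC addrK addrC.
Qed.

Lemma perp_twist psi (h : {additive T -> RmodZ R}) :
  perp (twist psi h) = perp psi.
Proof.
by apply/setP=> t; rewrite !inE; apply: eq_forallb => s; rewrite assoc_form_twist.
Qed.

(** Both functions have the same [perp], and there [psi] vanishes, so the twist restricts to [h]. *)
Lemma tame_twist psi (h : {additive T -> RmodZ R}) : tame psi ->
  tame (twist psi h) <-> (forall t, t \in perp psi -> h t = 0).
Proof.
move=> psi_tame; rewrite /tame perp_twist /twist.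
by split=> h0 t tp; have := h0 t tp; rewrite psi_tame // add0r.
Qed.

End CharacterSums.

Theorem theorem1p14 (R : realType) (T : finZmodType) (psi : T -> RmodZ R)
    (psi_2linear : two_linear psi) (psi_tame : tame psi)
    (h : {additive T -> RmodZ R}) (h_rational : forall t : T, QmodZ (h t)) :
  (tame (twist psi h) <-> (forall t : T, t \in perp psi -> h t = 0)) /\
  (tame (twist psi h) ->
     (exists! c : coset_of (perp psi), represents psi h c) /\
     (forall c : coset_of (perp psi), represents psi h c ->
        exists v : RmodZ R,
          [/\ forall c1 : T, coset (perp psi) c1 = c -> psi c1 = v,
              gauss_sum psi != 0,
              gauss_sum (twist psi h) != 0
            & phase (twist psi h) = phase psi - v])).
Proof.
split=> [|h_tame]; first exact: tame_twist.
have h0 := (tame_twist _ _ _ _ psi_tame).1 h_tame.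
split=> [|c hc].
  have [c1 hc1] := assoc_form_represents _ _ _ _ psi_2linear (raddfD h) h0.
  exists (coset (perp psi) c1); split=> [c2 /eqP|c hc].
    (* Any other lift [c2] differs from [c1] by an element of [perp psi], which pairs to zero with
       every [t]. *)
    rewrite coset_perp_eq // => /perpP c21 t; rewrite hc1 -{1}[c2](subrK c1).
    by have [bl _] := psi_2linear; rewrite bl /= c21 add0r.
  have [c2 c2E] := coset_perp_surj c; rewrite -c2E; apply/eqP.
  rewrite coset_perp_eq //; apply/perpP => t; have [bl _] := psi_2linear.
  (* Uniqueness: [c1] and [c2] both represent [h], so the form vanishes at their difference. *)
  apply: (addIr (assoc_form psi c2 t)).
  by rewrite -bl /= subrK add0r -hc1 -(hc _ c2E).
have [c1 c1E] := coset_perp_surj c.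
have G0 := gauss_sum_neq0 _ _ _ psi_2linear psi_tame.
have Gh0 := gauss_sum_neq0 _ _ _ (two_linear_twist h psi_2linear) h_tame.
exists (psi c1); split=> // [c2 /eqP|].
  (* Expand [psi] at (c2 - c1) + c1: the form term dies because c2 - c1 lies in [perp psi], and
     psi(c2 - c1) = 0 by tameness. *)
  rewrite -c1E coset_perp_eq // => c21; rewrite -(subrK c1 c2) two_linearD.
  by rewrite (perpP _ _ c21) psi_tame // !add0r.
(* By [phaseP] it suffices to check the polar equation; the factor [expRZ (- psi c1)] has norm 1, so
   it changes only the phase. *)
apply/esym/phaseP => //; rewrite (gauss_sum_twist _ _ _ _ _ (hc _ c1E)).
have GE : gauss_sum psi = `|gauss_sum psi| * expRZ (phase psi) by apply/phaseP.
by rewrite normrM normr_expRZ mul1r expRZD {1}GE mulrC mulrA.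
Qed.
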